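(* Let $-2\pi<\theta<2\pi$, $\theta\neq0$, and $(x,v)\in\Gamma_\theta$. Then $\frac{1}{2}d_H((0,1),(x,v))^2=\Lambda(x,\theta)$. In addition, if $\theta=0$ and $(x,v)\in\Gamma_0$, then $x=0$ and $\frac{1}{2}d_H((0,1),(0,v))^2=2(\sqrt v-1)^2$.
   Context: Let $\mathcal{H}=\{(x,v)\in\mathbb{R}^2:v\ge0\}$ and let $d_H$ be the Riemannian distance on $\mathcal{H}$ induced by the metric $ds^2=v^{-1}(dx^2+dv^2)$ on the open upper half-plane (extended to the boundary). For $v\ge0$ and $0<|\delta|<2\pi$ set $$f(v,\delta)=\frac{(v+1)(\delta-\sin\delta)+2\sqrt v\,(2\sin\frac{\delta}{2}-\delta\cos\frac{\delta}{2})}{2\sin^2\frac{\delta}{2}},$$ and $f(v,0)=0$. For $(x,v)\in\mathcal{H}$, $\delta(x,v)$ denotes the unique $\delta\in(-2\pi,2\pi)$ with $f(v,\delta)=x$. For $-2\pi<\theta<2\pi$, $\Gamma_\theta=\{(x,v)\in\mathcal{H}:\delta(x,v)=\theta\}$. For $\theta\ne0$ and admissible $x$ (the expression under the root nonnegative), $$\Lambda(x,\theta)=\frac{\theta^2}{(\theta-\sin\theta)^2}\Big[(\theta-\sin\theta)x+2(1-\cos\theta)-\theta\sin\theta-(1-\cos\theta)\sqrt{2(\theta-\sin\theta)x+2(1-\cos\theta)-\theta^2}\Big],$$ with the nonnegative square root. *)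

(* Defs.v *)
From HB Require Import structures.
From mathcomp Require Import all_boot all_order all_algebra.
From mathcomp Require Import all_classical all_reals all_analysis.
Set Implicit Arguments. Unset Strict Implicit. Unset Printing Implicit Defensive.
Import Order.TTheory GRing.Theory Num.Theory.
Import numFieldNormedType.Exports.
Local Open Scope classical_set_scope.
Local Open Scope ring_scope.

Section Defs.
Variable R : realType.

Definition fH (v d : R) : R :=
  if d == 0 then 0 else
  ((v + 1) * (d - sin d) + 2 * Num.sqrt v * (2 * sin (d / 2) - d * cos (d / 2)))
  / (2 * (sin (d / 2)) ^+ 2).

Definition inGamma (theta x v : R) : Prop :=
  0 <= v /\ - (2 * pi) < theta < 2 * pi /\ fH v theta = x /\
  (forall d : R, - (2 * pi) < d < 2 * pi -> fH v d = x -> d = theta).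

Definition LambdaRad (x th : R) : R :=
  2 * (th - sin th) * x + 2 * (1 - cos th) - th ^+ 2.

Definition Lambda (x th : R) : R :=
  th ^+ 2 / (th - sin th) ^+ 2 *
  ((th - sin th) * x + 2 * (1 - cos th) - th * sin th
   - (1 - cos th) * Num.sqrt (LambdaRad x th)).

(* Length density of the metric v^{-1}(dx^2 + dv^2) along a curve (gx,gv);
   on the boundary v = 0 the metric is infinite: density +oo unless the
   velocity vanishes. *)
Definition hspeed (gx gv : R -> R) (t : R) : \bar R :=
  if gv t == 0 then
    (if (derive1 gx t == 0) && (derive1 gv t == 0) then 0%E else +oo%E)
  else (Num.sqrt ((derive1 gx t) ^+ 2 + (derive1 gv t) ^+ 2) / Num.sqrt (gv t))%:E.

Definition hlength (gx gv : R -> R) : \bar R :=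
  (\int[lebesgue_measure]_(t in `[0%R, 1%R]) hspeed gx gv t)%E.

(* admissible curves: C^1 (restrictions to [0,1] of C^1 maps R -> R^2),
   staying in the closed half-plane, from p to q *)
Definition adm_curve (p q : R * R) (gx gv : R -> R) : Prop :=
  (forall t, derivable gx t 1 /\ derivable gv t 1) /\
  continuous (derive1 gx) /\ continuous (derive1 gv) /\
  (forall t, 0 <= t <= 1 -> 0 <= gv t) /\
  (gx 0, gv 0) = p /\ (gx 1, gv 1) = q.

Definition dH (p q : R * R) : \bar R :=
  ereal_inf [set L | exists gx gv, adm_curve p q gx gv /\ L = hlength gx gv].

End Defs.

(* Main.v *)
(** With theta = 2 w, AM-GM bounds the energy of a curve (x, v = u^2) on [0,1]
    below by the integral of theta x' + 2 (u'^2 - w^2 u^2).  The minimisers of the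
    last functional solve u'' = - w^2 u; for such a u, positive on [0,1], the function
    theta x + 2 (u'/u)(t) v calibrates the metric, because c = u'/u satisfies the
    Riccati equation c' = - (c^2 + w^2).  It is linear in v, hence smooth up to the
    boundary v = 0.  The curve v = u^2, x' = theta u^2 is an arc of a cycloid, has
    constant speed 2 sqrt (u'^2 + w^2 u^2), and attains the bound.  When v = 0 the
    optimal u vanishes at t = 1 and is approached by solutions with u(1) = e > 0. *)
Require Import Defs.
From HB Require Import structures.
From mathcomp Require Import all_boot all_order all_algebra.
From mathcomp Require Import all_classical all_reals all_analysis.
From mathcomp Require Import ring lra.
Set Implicit Arguments. Unset Strict Implicit. Unset Printing Implicit Defensive.
Import Order.TTheory GRing.Theory Num.Theory.
Import numFieldNormedType.Exports.
Local Open Scope classical_set_scope.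
Local Open Scope ring_scope.

(** * Integration and mean-value tools *)

(** The integral of a nonnegative function is a supremum over the simple functions below it, and
    that set grows with the function. This permits comparisons with [hspeed] without proving it
    measurable. *)
Lemma ge0_le_integral_no_measurability (d : measure_display) (T : measurableType d)
    (R : realType) (mu : {measure set T -> \bar R}) (D : set T) (f g : T -> \bar R) :
  (forall x, D x -> (0 <= f x)%E) -> (forall x, D x -> (f x <= g x)%E) ->
  (\int[mu]_(x in D) f x <= \int[mu]_(x in D) g x)%E.
Proof.
move=> f0 fg.
have g0 x : D x -> (0 <= g x)%E by move=> Dx; apply: le_trans (fg _ Dx); exact: f0.
rewrite !ge0_integralE//; apply: ereal_sup_le => _ [h hf <-].
exists h => // x; apply: (le_trans (hf x)).
by rewrite /patch; case: ifPn => // /set_mem; exact: fg.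
Qed.

Lemma continuous_antiderivative (R : realType) (q : R -> R) : continuous q ->
  exists F : R -> R, [/\ F 0 = 0,
    F 1 = \int[lebesgue_measure]_(t in `[0%R, 1%R]) q t &
    forall t : R, 0 <= t <= 1 -> is_derive t 1 F (q t)].
Proof.
move=> cq.
have iq (a b : R) : lebesgue_measure.-integrable `[a, b] (EFin \o q).
  by apply: continuous_compact_integrable;
    [exact: segment_compact | exact: continuous_subspaceT].
(* Starting the integral at -1 and ending it at 2 makes 0 and 1 interior points, so the derivatives
   there are two-sided. *)
pose P (x : R) : R := \int[lebesgue_measure]_(t in `[(-1)%R, x]) q t.
have dP (x : R) : 0 <= x <= 1 -> is_derive x 1 P (q x).
  move=> /andP[x0 x1].
  have x2 : x < 2 by lra.
  have m1x : -1 < x by lra.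
  have [dPx ePx] : derivable P x 1 /\ derive1 P x = q x.
    exact: continuous_FTC1_closed x2 (iq _ _) m1x (cq x).
  by apply: DeriveDef; [exact: dPx | rewrite -derive1E].
exists (fun x => P x - P 0); split; first by rewrite subrr.
- rewrite /P (@Rintegral_itvB _ q (BLeft (-1)) (BRight 1) 0 (iq _ _)) ?bnd_simp.
  + rewrite (@Rintegral_itv_obnd_cbnd _ 0 (BRight 1) q)//.
    apply: (integrableS _ _ _ (iq 0 1)) => //.
    exact: subset_itv_oc_cc.
  + lra.
  + lra.
- move=> t t01; have dPt := dP t t01.
  apply: (is_derive_eq (is_deriveB dPt (is_derive_cst (P 0) t 1))).
  by rewrite subr0.
Qed.

Lemma mean_value_is_derive (R : realType) (f df : R -> R) (a b : R) : a <= b ->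
  (forall t, a <= t <= b -> is_derive t 1 f (df t)) ->
  exists2 c, a <= c <= b & f b - f a = df c * (b - a).
Proof.
move=> ab dfE; have [||c] := @MVT_segment R f df a b ab.
- by move=> t; rewrite in_itv/= => /andP[ta tb]; apply: dfE; rewrite !ltW.
- apply: derivable_within_continuous => t; rewrite in_itv/= => /dfE tE.
  exact: ex_derive.
- by rewrite in_itv/= => ? ?; exists c.
Qed.

(** * Calibration lower bound for lengths *)

(** With [k ^+ 2 = c ^+ 2 + w ^+ 2], Cauchy-Schwarz bounds the left side by [2 * k * m * q], and
    AM-GM splits this product. The weights are such that the first term is cancelled by the Riccati
    equation in the time [F / A], whose rate is [q / A], and the second integrates to
    [A ^+ 2 / 2]. *)
Lemma calibration_rate (R : realType) (w c dx dv m A q : R) : 0 < m -> 0 < A ->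
  Num.sqrt (dx ^+ 2 + dv ^+ 2) / m <= q ->
  2 * w * dx + 2 * c * dv <= 2 * (c ^+ 2 + w ^+ 2) * m ^+ 2 * (q / A) + A / 2 * q.
Proof.
move=> m0 A0 rq.
set r := Num.sqrt (dx ^+ 2 + dv ^+ 2) in rq.
pose k := Num.sqrt (c ^+ 2 + w ^+ 2).
have k0 : 0 <= k by exact: sqrtr_ge0.
have r0 : 0 <= r by exact: sqrtr_ge0.
have kE : k ^+ 2 = c ^+ 2 + w ^+ 2 by rewrite sqr_sqrtr// addr_ge0 ?sqr_ge0.
have rE : r ^+ 2 = dx ^+ 2 + dv ^+ 2 by rewrite sqr_sqrtr// addr_ge0 ?sqr_ge0.
have q0 : 0 <= q by apply: le_trans rq; rewrite divr_ge0// ltW.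
have rmq : r <= m * q by rewrite mulrC -ler_pdivrMr.
have cs : w * dx + c * dv <= k * r.
  apply: (le_trans (ler_norm _)).
  rewrite -(@ler_pXn2r _ 2)// ?nnegrE ?mulr_ge0// real_normK ?num_real//.
  rewrite exprMn kE rE -subr_ge0.
  have -> : (c ^+ 2 + w ^+ 2) * (dx ^+ 2 + dv ^+ 2) - (w * dx + c * dv) ^+ 2 =
    (w * dv - c * dx) ^+ 2 by ring.
  exact: sqr_ge0.
have kr : k * r <= k * (m * q) by exact: ler_wpM2l.
rewrite -kE -subr_ge0.
have -> : 2 * k ^+ 2 * m ^+ 2 * (q / A) + A / 2 * q - (2 * w * dx + 2 * c * dv) =
  q * (2 * k * m - A) ^+ 2 / (2 * A)
  + 2 * (k * (m * q) - (w * dx + c * dv)) by field; exact: lt0r_neq0.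
rewrite addr_ge0//; last by lra.
by apply: divr_ge0; rewrite mulr_ge0 ?sqr_ge0// ltW.
Qed.

Lemma calibration_regularised (R : realType) (gx gv c q : R -> R) (w e : R) :
  0 < e ->
  (forall t : R, 0 <= t <= 1 -> derivable gx t 1) ->
  (forall t : R, 0 <= t <= 1 -> derivable gv t 1) ->
  (forall t : R, 0 <= t <= 1 -> 0 <= gv t) ->
  (forall t : R, 0 <= t <= 1 -> is_derive t 1 c (- (c t ^+ 2 + w ^+ 2))) ->
  continuous q -> (forall t, 0 < q t) ->
  (forall t : R, 0 <= t <= 1 ->
    Num.sqrt (derive1 gx t ^+ 2 + derive1 gv t ^+ 2) / Num.sqrt (gv t + e) <= q t) ->
  2 * w * (gx 1 - gx 0) + 2 * (c 1 * (gv 1 + e) - c 0 * (gv 0 + e)) <=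
  (\int[lebesgue_measure]_(t in `[0%R, 1%R]) q t) ^+ 2 / 2.
Proof.
move=> e0 dgx dgv gv0 dc cq q0 hq.
have [F [F0 <- dF]] := continuous_antiderivative cq.
set A := F 1.
have Fge0 (t : R) : 0 <= t <= 1 -> 0 <= F t.
  move=> /andP[t0 t1].
  have [||z _] := @mean_value_is_derive R F q 0 t => //.
    by move=> s /andP[s0 st]; apply: dF; rewrite s0 (le_trans st).
  by rewrite F0 !subr0 => ->; rewrite mulr_ge0// ltW.
have FleA (t : R) : 0 <= t <= 1 -> F t <= A.
  move=> /andP[t0 t1].
  have [||z _] := @mean_value_is_derive R F q t 1 => //.
    by move=> s /andP[s0 st]; apply: dF; rewrite st andbT (le_trans t0).
  by rewrite -subr_ge0 -/A => ->; rewrite mulr_ge0 ?subr_ge0// ltW.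
have A0 : 0 < A.
  have [z _] := mean_value_is_derive ler01 dF.
  by rewrite F0 !subr0 mulr1 -/A => ->.
(* The Riccati equation for [c] is given on [0,1] only, so the normalised arc length has to stay
   there. *)
have sig (t : R) : 0 <= t <= 1 -> 0 <= F t / A <= 1.
  move=> t01; apply/andP; split; first exact: divr_ge0 (Fge0 _ t01) (ltW A0).
  by rewrite ler_pdivrMr// mul1r; exact: FleA.
(* Calibration minus its largest allowed growth: [G] has derivative at most 0 by [calibration_rate],
   and comparing its values at 0 and 1 gives the claim. *)
pose G (t : R) : R :=
  2 * w * gx t + 2 * (c (A^-1 * F t) * (gv t + e)) - A / 2 * F t.
pose dG (t : R) : R := 2 * w * derive1 gx t
  + 2 * (c (A^-1 * F t) * derive1 gv t +
     (gv t + e) * (- (c (A^-1 * F t) ^+ 2 + w ^+ 2) * (A^-1 * q t))) - A / 2 * q t.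
have isG (t : R) : 0 <= t <= 1 -> is_derive t 1 G (dG t).
  move=> t01.
  have dx : is_derive t 1 gx (derive1 gx t).
    by rewrite derive1E; exact/derivableP/dgx.
  have dv : is_derive t 1 gv (derive1 gv t).
    by rewrite derive1E; exact/derivableP/dgv.
  have dFt := dF t t01.
  have ds : is_derive t 1 (fun t : R => A^-1 * F t) (A^-1 * q t).
    exact: (is_deriveZ A^-1 dFt).
  have dcs : is_derive t 1 (fun t : R => c (A^-1 * F t))
     (- (c (A^-1 * F t) ^+ 2 + w ^+ 2) * (A^-1 * q t)).
    apply: is_derive1_comp; apply: dc; rewrite mulrC; exact: sig.
  have dve : is_derive t 1 (fun t : R => gv t + e) (derive1 gv t).
    by apply: (is_derive_eq (is_deriveD dv (is_derive_cst e t 1))); rewrite addr0.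
  exact: (is_deriveB (is_deriveD (is_deriveZ (2 * w) dx)
    (is_deriveZ 2 (is_deriveM dcs dve))) (is_deriveZ (A / 2) dFt)).
have [z z01] := mean_value_is_derive ler01 isG.
rewrite /G F0 -/A mulVf ?gt_eqF// !mulr0 !subr0 mulr1 => Gz.
have m0 : 0 < Num.sqrt (gv z + e) by rewrite sqrtr_gt0 ltr_wpDl ?gv0.
have := @calibration_rate _ w (c (A^-1 * F z)) _ _ _ _ _ m0 A0 (hq z z01).
rewrite sqr_sqrtr; last by rewrite addr_ge0 ?gv0// ltW.
move=> hz.
have dGz : dG z <= 0.
  by rewrite /dG -subr_ge0; apply: le_trans (_ : 0 <= _ - _) _;
   [rewrite subr_ge0; exact: hz|rewrite le_eqVlt; apply/orP; left; apply/eqP; ring].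
have -> : A ^+ 2 / 2 = A / 2 * A by ring.
lra.
Qed.

Lemma ler_linear_perturbation (R : realType) (a b M : R) :
  (forall e, 0 < e -> e <= 1 -> a <= b + e * M) -> a <= b.
Proof.
move=> h; apply/ler_addgt0Pr => e e0.
have M1 : 0 < 1 + `|M| by rewrite ltr_pwDl.
pose e' := Num.min 1 (e / (1 + `|M|)).
have e'0 : 0 < e' by rewrite lt_min ltr01 divr_gt0.
have e'1 : e' <= 1 by rewrite ge_min lexx.
apply: (le_trans (h _ e'0 e'1)); rewrite lerD2l.
apply: (@le_trans _ _ (e' * (1 + `|M|))).
  by rewrite ler_wpM2l ?(ltW e'0)// (le_trans (ler_norm M))// lerDr.
by rewrite -ler_pdivlMr// ge_min lexx orbT.
Qed.

Lemma hspeed_ge0 (R : realType) (gx gv : R -> R) t : (0 <= hspeed gx gv t)%E.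
Proof.
rewrite /hspeed; case: ifPn => _; last by rewrite lee_fin divr_ge0 ?sqrtr_ge0.
by case: ifPn => _; rewrite ?leey.
Qed.

Lemma regularised_speed_le_hspeed (R : realType) (gx gv : R -> R) (e t : R) :
  0 <= e -> 0 <= gv t ->
  ((Num.sqrt (derive1 gx t ^+ 2 + derive1 gv t ^+ 2) / Num.sqrt (gv t + e))%:E
    <= hspeed gx gv t)%E.
Proof.
move=> e0 v0; rewrite /hspeed; case: ifPn => [_|vN0].
  case: ifPn => [/andP[/eqP -> /eqP ->]|_]; last exact: leey.
  by rewrite expr0n/= addr0 sqrtr0 mul0r.
have v_gt0 : 0 < gv t by rewrite lt0r vN0.
rewrite lee_fin ler_wpM2l ?sqrtr_ge0// lef_pV2 ?posrE ?sqrtr_gt0 ?ltr_wpDr//.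
by rewrite ler_wsqrtr// lerDl.
Qed.

(** The absolute value keeps the denominator positive on the whole line, while admissible curves
    have [v] nonnegative only on [0,1]. *)
Lemma continuous_regularised_speed (R : realType) (dx dv v : R -> R) (e : R) :
  0 < e -> continuous dx -> continuous dv -> continuous v ->
  continuous (fun t => Num.sqrt (dx t ^+ 2 + dv t ^+ 2) / Num.sqrt (`|v t| + e)).
Proof.
move=> e0 cx cdv cv t.
have m0 : Num.sqrt (`|v t| + e) != 0 by rewrite gt_eqF// sqrtr_gt0 ltr_wpDl.
have csqrt (f : R -> R) : {for t, continuous f} ->
    {for t, continuous (fun t => Num.sqrt (f t))}.
  by move=> cf; apply: continuous_comp; [exact: cf | exact: sqrt_continuous].
apply: cvgM; last apply: (cvgV m0); apply: csqrt; apply: cvgD.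
- by apply: cvgM; exact: cx.
- by apply: cvgM; exact: cdv.
- by apply: cvg_norm; exact: cv.
- exact: cvg_cst.
Qed.

(* Reparametrise time by normalised arc length s: then 2 w x + 2 c(s) v grows at rate
   at most L/2 times the speed.  The arc length is infinitely dense at v = 0, so it is
   first regularised by e, which costs the shift of v by e in the calibration. *)
Lemma hlength_calibration (R : realType) (p q : R * R) (gx gv c : R -> R) (w L : R) :
  adm_curve p q gx gv ->
  (forall t : R, 0 <= t <= 1 -> is_derive t 1 c (- (c t ^+ 2 + w ^+ 2))) ->
  hlength gx gv = L%:E ->
  2 * w * (q.1 - p.1) + 2 * (c 1 * q.2 - c 0 * p.2) <= L ^+ 2 / 2.
Proof.
move=> [dg [cdx [cdv [v0 [<- <-]]]]] dc hL /=.
have L0 : 0 <= L.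
  by rewrite -lee_fin -hL; apply: integral_ge0 => t _; exact: hspeed_ge0.
have cv : continuous gv.
  move=> t; apply/differentiable_continuous/derivable1_diffP.
  by have [] := dg t.
(* [L + 1 / 2] comes from expanding [(L + e) ^+ 2 / 2] with [e * e <= e]; the last term is the
   effect of shifting [v] by [e]. *)
apply: (@ler_linear_perturbation _ _ _ (L + 1 / 2 - 2 * (c 1 - c 0))) => e e0 e1.
pose g (t : R) : R :=
  Num.sqrt (derive1 gx t ^+ 2 + derive1 gv t ^+ 2) / Num.sqrt (`|gv t| + e).
have cg : continuous g by exact: continuous_regularised_speed.
have g0 t : 0 <= g t by rewrite divr_ge0 ?sqrtr_ge0.
have ig (f : R -> R) : continuous f ->
    lebesgue_measure.-integrable `[0%R, 1%R] (EFin \o f).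
  by move=> cf; apply: continuous_compact_integrable;
    [exact: segment_compact | exact: continuous_subspaceT].
(* Adding [e] makes the density strictly positive even where the curve stops, at the price of
   [L + e] in place of [L]. *)
have cge : continuous (fun t => g t + e).
  by move=> t; apply: cvgD; [exact: cg | exact: cvg_cst].
have hge (t : R) : 0 <= t <= 1 ->
    Num.sqrt (derive1 gx t ^+ 2 + derive1 gv t ^+ 2) / Num.sqrt (gv t + e) <= g t + e.
  by move=> t01; rewrite /g ger0_norm ?v0// lerDl ltW.
have ge0 (t : R) : 0 < g t + e by rewrite ltr_wpDl.
have := calibration_regularised e0 (fun t _ => (dg t).1) (fun t _ => (dg t).2)
  v0 dc cge ge0 hge.
set A := Rintegral _ _ _ => hA.
have A0 : 0 <= A by apply: Rintegral_ge0 => t _; exact: ltW.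
have AL : A <= L + e.
  rewrite /A RintegralD//; [|exact: ig|by apply: ig => t; exact: cvg_cst].
  apply: lerD.
    rewrite -lee_fin /Rintegral fineK; last exact: integrable_fin_num (ig _ cg).
    rewrite -hL; apply: ge0_le_integral_no_measurability => t /=.
      by rewrite lee_fin.
    rewrite in_itv/= => t01; rewrite /g ger0_norm ?v0//.
    by apply: regularised_speed_le_hspeed; [exact: ltW | exact: v0].
  rewrite Rintegral_cst//= lebesgue_measure_itv/= lte_fin ltr01/= subr0 mulr1.
  exact: lexx.
have A2 : A ^+ 2 <= (L + e) ^+ 2 by rewrite ler_pXn2r// ?nnegrE// addr_ge0// ltW.
have ee : e * e <= e by rewrite ler_piMr// ltW.
have E : (L + e) ^+ 2 / 2 = L ^+ 2 / 2 + e * L + e * e / 2 by field.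
lra.
Qed.

(** Lengths are nonnegative, so the lower bound may be tested on squares, the form in which the
    calibration delivers it; curves of infinite length satisfy it trivially. *)
Lemma dH_eq (R : realType) (p q : R * R) (K : R) :
  (exists gx gv, adm_curve p q gx gv /\ (hlength gx gv <= K%:E)%E) ->
  (forall gx gv L, adm_curve p q gx gv -> hlength gx gv = L%:E ->
     K ^+ 2 / 2 <= L ^+ 2 / 2) ->
  dH p q = K%:E.
Proof.
move=> [gx [gv [adm hK]]] lower; apply/eqP; rewrite eq_le; apply/andP; split.
  by apply: ge_ereal_inf; exists (hlength gx gv) => //; exists gx, gv.
apply: le_ereal_inf_tmp => _ [fx [fv [fadm ->]]].
have L0 : (0 <= hlength fx fv)%E by apply: integral_ge0 => t _; exact: hspeed_ge0.
case hL : (hlength fx fv) L0 => [L| |]// => [L0|_]; last exact: leey.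
rewrite lee_fin; apply: (le_trans (ler_norm K)).
rewrite -(@ler_pXn2r _ 2)// ?nnegrE// real_normK ?num_real//.
by have := lower _ _ _ fadm hL; lra.
Qed.

(** * Solutions of u'' = - w^2 u: their calibrations and their curves *)

Lemma jacobi_riccati (R : realType) (w : R) (u du : R -> R) (t : R) :
  (forall t : R, is_derive t 1 u (du t)) ->
  (forall t : R, is_derive t 1 du (- (w ^+ 2 * u t))) ->
  u t != 0 ->
  is_derive t 1 (fun t => du t / u t) (- ((du t / u t) ^+ 2 + w ^+ 2)).
Proof.
move=> uE duE u0; have dut := uE t; have ddut := duE t.
apply: (is_derive_eq (is_deriveM ddut (is_deriveV u0 dut))).
by rewrite /GRing.scale/=; field.
Qed.

Lemma jacobi_lower_bound (R : realType) (w : R) (u du : R -> R) 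
    (x v L : R) (gx gv : R -> R) :
  (forall t : R, is_derive t 1 u (du t)) ->
  (forall t : R, is_derive t 1 du (- (w ^+ 2 * u t))) ->
  u 0 = 1 -> (forall t : R, 0 <= t <= 1 -> 0 < u t) ->
  adm_curve (0, 1) (x, v) gx gv -> hlength gx gv = L%:E ->
  2 * w * x + 2 * (du 1 / u 1 * v - du 0) <= L ^+ 2 / 2.
Proof.
move=> uE duE u01 u_gt0 adm hL.
have dc (t : R) : 0 <= t <= 1 ->
    is_derive t 1 (fun t => du t / u t) (- ((du t / u t) ^+ 2 + w ^+ 2)).
  by move=> t01; apply: jacobi_riccati => //; rewrite gt_eqF// u_gt0.
have := hlength_calibration adm dc hL.
by rewrite /= u01 subr0 divr1 mulr1.
Qed.

(** The squared Euclidean speed is [4 * u ^+ 2 * e], so division by [v = u ^+ 2] leaves the constant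
    density [2 * Num.sqrt e]. At a zero of [u] the velocity vanishes as well and [hspeed] is 0, so
    the density is only bounded by that constant. *)
Lemma jacobi_curve (R : realType) (w : R) (u du : R -> R) (gx : R -> R) (e : R) :
  (forall t : R, is_derive t 1 u (du t)) ->
  (forall t : R, is_derive t 1 du (- (w ^+ 2 * u t))) ->
  (forall t : R, is_derive t 1 gx (2 * w * u t ^+ 2)) ->
  (forall t : R, du t ^+ 2 + w ^+ 2 * u t ^+ 2 = e) ->
  adm_curve (gx 0, u 0 ^+ 2) (gx 1, u 1 ^+ 2) gx (fun t => u t ^+ 2) /\
  (hlength gx (fun t => u t ^+ 2)%R <= (2 * Num.sqrt e)%:E)%E.
Proof.
move=> uE duE gxE energy.
have cont (f df : R -> R) : (forall t : R, is_derive t 1 f (df t)) -> continuous f.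
  move=> fE t; apply/differentiable_continuous/derivable1_diffP.
  by have [] := fE t.
have cu := cont _ _ uE; have cdu := cont _ _ duE.
have vE (t : R) : is_derive t 1 (fun t => u t ^+ 2) (2 * u t * du t).
  by apply: (is_derive_eq (is_deriveX 2 (uE t))); rewrite /GRing.scale/= expr1.
have d1x : derive1 gx = (fun t => 2 * w * u t ^+ 2).
  by apply/funext => t; rewrite derive1E; have [] := gxE t.
have d1v : derive1 (fun t => u t ^+ 2) = (fun t => 2 * u t * du t).
  by apply/funext => t; rewrite derive1E; have [] := vE t.
split.
  split; [|split; [|split; [|split; [|split]]]] => //.
  - by rewrite d1x => t; apply: cvgM; [exact: cvg_cst | apply: cvgM; exact: cu].
  - rewrite d1v => t; apply: cvgM; last exact: cdu.
    by apply: cvgM; [exact: cvg_cst | exact: cu].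
  - by move=> t _; exact: sqr_ge0.
apply: (@le_trans _ _ (\int[lebesgue_measure]_(t in `[0%R, 1%R]) (2 * Num.sqrt e)%:E)%E).
  apply: ge0_le_integral_no_measurability => t _; first exact: hspeed_ge0.
  rewrite /hspeed d1x d1v sqrf_eq0; case: ifPn => [/eqP ->|u0].
    rewrite expr0n/= !mulr0 mul0r eqxx/= lee_fin.
    by rewrite mulr_ge0// sqrtr_ge0.
  rewrite lee_fin ler_pdivrMr; last by rewrite sqrtr_gt0 exprn_even_gt0.
  rewrite (_ : _ + _ = (2 * u t) ^+ 2 * e); last by rewrite -(energy t); ring.
  rewrite sqrtrM ?sqr_ge0// !sqrtr_sqr normrM ger0_norm// mulrAC.
  exact: lexx.
rewrite integral_cst//= lebesgue_measure_itv/= lte_fin ltr01/= sube0 mule1.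
exact: lexx.
Qed.

(** * Trigonometric derivatives and signs *)

Lemma is_derive_harmonic (R : realType) (w a b t : R) :
  is_derive t 1 (fun t => a * cos (w * t) + b * sin (w * t))
    (w * (b * cos (w * t) - a * sin (w * t))).
Proof.
have dw : is_derive t 1 (fun t : R => w * t) w.
  by apply: (is_derive_eq (is_deriveZ w (is_derive_id t 1))); exact: mulr1.
have dc := is_derive1_comp (is_derive_cos (w * t)) dw.
have ds := is_derive1_comp (is_derive_sin (w * t)) dw.
apply: (is_derive_eq (is_deriveD (is_deriveZ a dc) (is_deriveZ b ds))).
by rewrite /GRing.scale/=; ring.
Qed.

Lemma sin_ratio_gt0 (R : realType) (w t : R) : w != 0 -> - pi < w < pi ->
  0 < t <= 1 -> 0 < sin (w * t) / sin w.
Proof.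
move=> w0 /andP[wlo whi] /andP[t0 t1].
wlog w_gt0 : w w0 wlo whi / 0 < w => [hw|].
  have [wp|] := ltP 0 w; first exact: hw.
  rewrite le_eqVlt (negbTE w0)/= => wn.
  have := hw (- w); rewrite mulNr !sinN invrN mulrNN; apply; rewrite ?oppr_eq0//.
  - by rewrite ltrN2.
  - by rewrite ltrNl.
  - by rewrite oppr_gt0.
rewrite divr_gt0// sin_gt0_pi ?w_gt0// mulr_gt0//=.
by apply: le_lt_trans whi; rewrite ler_piMr// ltW.
Qed.

(** The expression vanishes at 0 and has derivative [t * sin t]. *)
Lemma sinB_mul_cos_gt0 (R : realType) (w : R) : 0 < w < pi -> 0 < sin w - w * cos w.
Proof.
move=> /andP[w0 wpi].
have dF (t : R) : is_derive t 1 (fun t => sin t - t * cos t) (t * sin t).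
  apply: (is_derive_eq (is_deriveB (is_derive_sin t)
    (is_deriveM (is_derive_id t 1) (is_derive_cos t)))).
  by rewrite /GRing.scale/=; ring.
have cF : {within `[0, w], continuous (fun t : R => sin t - t * cos t)}.
  by apply: derivable_within_continuous => t _; case: (dF t).
have [t] := MVT w0 (fun t _ => dF t) cF.
rewrite in_itv/= sin0 mul0r !subr0 => /andP[t0 tw] ->.
have st : 0 < sin t by apply: sin_gt0_pi; rewrite t0 (lt_trans tw).
by rewrite !mulr_gt0.
Qed.

Lemma subr_sin_mul_cos_gt0 (R : realType) (w : R) : 0 < w < pi -> 0 < w - sin w * cos w.
Proof.
move=> /andP[w0 wpi].
have dF (t : R) : is_derive t 1 (fun t => t - sin t * cos t) (2 * sin t ^+ 2).
  apply: (is_derive_eq (is_deriveB (is_derive_id t 1)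
    (is_deriveM (is_derive_sin t) (is_derive_cos t)))).
  by rewrite /GRing.scale/=; have := cos2Dsin2 t; lra.
have cF : {within `[0, w], continuous (fun t : R => t - sin t * cos t)}.
  by apply: derivable_within_continuous => t _; case: (dF t).
have [t] := MVT w0 (fun t _ => dF t) cF.
rewrite in_itv/= sin0 mul0r !subr0 => /andP[t0 tw] ->.
have st : 0 < sin t by apply: sin_gt0_pi; rewrite t0 (lt_trans tw).
by rewrite !mulr_gt0.
Qed.

(** * Distances from (0,1) *)

(** The minimiser is [u t = cos (w * t) + k * sin (w * t)]: [k] is fixed by u(1) = y, [x] is the
    integral of [2 * w * u ^+ 2] over [0,1], and the conserved energy is [w ^+ 2 * (1 + k ^+ 2)]. *)
Lemma dH_harmonic (R : realType) (w y x k : R) : w != 0 -> - pi < w < pi -> 0 <= y ->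
  k = (y - cos w) / sin w ->
  x = w * (1 + k ^+ 2) - y * (k * cos w - sin w) + k ->
  dH (0, 1) (x, y ^+ 2) = (2 * Num.sqrt (w ^+ 2 * (1 + k ^+ 2)))%:E.
Proof.
move=> w0 wpi y0 kE xE.
have s0 : sin w != 0.
  have := @sin_ratio_gt0 R w 1 w0 wpi; rewrite ltr01 lexx mulr1 => /(_ isT).
  by apply: contraTneq => ->; rewrite invr0 mulr0 ltxx.
have cs2 t : sin t ^+ 2 = 1 - cos t ^+ 2 :> R by exact: sin2cos2.
pose u (k t : R) : R := 1 * cos (w * t) + k * sin (w * t).
pose du (k t : R) : R := w * (k * cos (w * t) - 1 * sin (w * t)).
have uE (k' t : R) : is_derive t 1 (u k') (du k' t) by exact: is_derive_harmonic.
have duE (k' t : R) : is_derive t 1 (du k') (- (w ^+ 2 * u k' t)).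
  have -> : du k' = (fun t : R => (w * k') * cos (w * t) + (- w) * sin (w * t)).
    by apply/funext => r; rewrite /du; ring.
  by apply: (is_derive_eq (is_derive_harmonic w (w * k') (- w) t)); rewrite /u; ring.
have u0 (k' : R) : u k' 0 = 1 by rewrite /u mulr0 cos0 sin0; ring.
apply: dH_eq.
(* An antiderivative of [2 * w * u ^+ 2], found by subtracting the derivative of u u' / w from
   [w * (1 + k ^+ 2)]; the final [k] makes it vanish at 0. *)
- pose gx (t : R) : R := w * (1 + k ^+ 2) * t
    - u k t * (k * cos (w * t) + (- 1) * sin (w * t)) + k.
  exists gx, (fun t : R => u k t ^+ 2).
  have -> : (0, 1) = (gx 0, u k 0 ^+ 2).
    by rewrite u0 expr1n /gx u0 !mulr0 cos0 sin0; congr pair; ring.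
  have uk1 : u k 1 = y by rewrite /u mulr1 kE; field.
  have -> : (x, y ^+ 2) = (gx 1, u k 1 ^+ 2).
    by rewrite uk1 /gx uk1 !mulr1 xE; congr pair; ring.
  apply: (jacobi_curve (uE k) (duE k)) => t.
    have dh := is_derive_harmonic w k (- 1) t.
    apply: (is_derive_eq (is_deriveD (is_deriveB
      (is_deriveZ (w * (1 + k ^+ 2)) (is_derive_id t 1))
      (is_deriveM (uE k t) dh)) (is_derive_cst k t 1))).
    rewrite /GRing.scale/= /du /u.
    by ring: (cs2 (w * t)).
  by rewrite /du /u; ring: (cs2 (w * t)).
- move=> gx gv L adm hL.
  (* The comparison solution ends at a free value [e > 0]: [e = y] is sharp for [y > 0], and [e]
     tends to 0 for [y = 0]. *)
  have lower (e k' : R) : 0 < e -> k' = (e - cos w) / sin w ->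
      2 * w * x + 2 * (du k' 1 / e * y ^+ 2 - w * k') <= L ^+ 2 / 2.
    move=> e_gt0 k'E.
    have uk1 : u k' 1 = e by rewrite /u mulr1 k'E; field.
    have u_gt0 (t : R) : 0 <= t <= 1 -> 0 < u k' t.
      move=> /andP[t0 t1].
      (* Written through its boundary values 1 and [e], the solution is visibly positive because |w|
         < pi. *)
      have -> : u k' t = sin (w * (1 - t)) / sin w + e * (sin (w * t) / sin w).
        by rewrite /u k'E mulrBr mulr1 sinB; field.
      have [->|t_gt0] := eqVneq t 0.
        by rewrite subr0 mulr1 mulr0 sin0 divff// mul0r mulr0 addr0.
      have [->|t_lt1] := eqVneq t 1.
        by rewrite subrr mulr1 mulr0 sin0 divff// mul0r mulr1 add0r.
      have t_pos : 0 < t by rewrite lt0r t_gt0.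
      have t_lt : t < 1 by rewrite lt_neqAle t_lt1.
      by rewrite addr_gt0 ?(mulr_gt0 e_gt0)//; apply: sin_ratio_gt0 => //; lra.
    have := jacobi_lower_bound (uE k') (duE k') (u0 k') u_gt0 adm hL.
    by rewrite uk1 [du k' 0]/du mulr0 cos0 sin0 mulr0 mulr1 subr0.
  rewrite exprMn sqr_sqrtr; last by rewrite mulr_ge0 ?addr_ge0 ?sqr_ge0.
  have [y_gt0|] := ltP 0 y.
    have := lower _ _ y_gt0 kE; rewrite /du mulr1 xE; apply: le_trans.
    by rewrite le_eqVlt; apply/orP; left; apply/eqP; field; rewrite gt_eqF.
  move=> yle0; have {yle0} y_eq0 : y = 0 by apply/eqP; rewrite eq_le yle0.
  (* Replacing [k] by [k'] adds [e / sin w], which enters the bound with factor [- (2 * w)]; the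
     term with [du k' 1 / e] is killed by [y = 0]. *)
  apply: (@ler_linear_perturbation _ _ _ (2 * w / sin w)) => e e_gt0 _.
  have := lower e _ e_gt0 erefl; rewrite -lerBlDr; apply: le_trans.
  rewrite le_eqVlt; apply/orP; left; apply/eqP.
  rewrite y_eq0 expr0n/= mulr0 sub0r xE kE y_eq0.
  by field.
Qed.

(** The degenerate case w = 0: solutions of u'' = 0 are affine, and the minimiser runs from 1 to [y]
    with [x] constant. *)
Lemma dH_vertical (R : realType) (y : R) : 0 <= y ->
  dH (0, 1) (0, y ^+ 2) = (2 * Num.sqrt ((y - 1) ^+ 2))%:E.
Proof.
move=> y0.
pose u (e t : R) : R := (e - 1) * t + 1.
have uE (e t : R) : is_derive t 1 (u e) (cst (e - 1) t).
  apply: (is_derive_eq (is_deriveD (is_deriveZ (e - 1) (is_derive_id t 1))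
    (is_derive_cst (1 : R) t 1))).
  by rewrite addr0 /GRing.scale/= mulr1.
have duE (e t : R) : is_derive t 1 (cst (e - 1)) (- (0 ^+ 2 * u e t)).
  by apply: (is_derive_eq (is_derive_cst (e - 1) t 1)); ring.
have u0 e : u e 0 = 1 by rewrite /u mulr0 add0r.
have u1 e : u e 1 = e by rewrite /u mulr1 subrK.
apply: dH_eq.
- exists (cst 0), (fun t : R => u y t ^+ 2).
  rewrite -[(0, y ^+ 2)]/(cst 0 (1 : R), y ^+ 2) -[(0, 1)]/(cst 0 (0 : R), 1).
  rewrite -[in y ^+ 2](u1 y) -[X in (_, X)](expr1n _ 2) -[in X in (_, X ^+ 2)](u0 y).
  apply: (jacobi_curve (uE y) (duE y)) => t; last by rewrite /=; ring.
  by apply: (is_derive_eq (is_derive_cst (0 : R) t 1)); ring.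
- move=> gx gv L adm hL.
  have lower (e : R) : 0 < e ->
      2 * ((e - 1) / e * y ^+ 2 - (e - 1)) <= L ^+ 2 / 2.
    move=> e_gt0.
    have u_gt0 (t : R) : 0 <= t <= 1 -> 0 < u e t.
      move=> /andP[t0 t1]; rewrite /u (_ : _ + _ = e * t + (1 - t)); last by ring.
      have [->|t_lt1] := eqVneq t 1; first by rewrite mulr1 subrr addr0.
      rewrite ltr_wpDl// ?subr_gt0 ?lt_neqAle ?t_lt1//.
      by rewrite mulr_ge0// ltW.
    have := jacobi_lower_bound (uE e) (duE e) (u0 e) u_gt0 adm hL.
    by rewrite u1 !mulr0 add0r.
  rewrite exprMn sqr_sqrtr ?sqr_ge0//.
  have [y_gt0|yle0] := ltP 0 y.
    apply: le_trans (lower _ y_gt0).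
    by rewrite le_eqVlt; apply/orP; left; apply/eqP; field; rewrite gt_eqF.
  have y_eq0 : y = 0 by apply/eqP; rewrite eq_le yle0.
  apply: (@ler_linear_perturbation _ _ _ 2) => e e_gt0 _.
  by have := lower e e_gt0; rewrite y_eq0 expr0n/= mulr0; lra.
Qed.

(** * Half-angle form of [fH] and [Lambda] *)

(** Both quotients are even in [w], which reduces the claim to [w > 0]. They fix the sign of the
    square root in [Lambda]. *)
Lemma cycloid_factors_gt0 (R : realType) (w : R) : w != 0 -> - pi < w < pi ->
  0 < (w - sin w * cos w) / sin w /\ 0 < (sin w - w * cos w) / sin w.
Proof.
move=> w0 /andP[wlo whi].
wlog w_gt0 : w w0 wlo whi / 0 < w => [hw|].
  have [wp|] := ltP 0 w; first exact: hw.
  rewrite le_eqVlt (negbTE w0)/= => wn.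
  have := hw (- w); rewrite sinN cosN invrN !mulNr -!opprD !mulrNN.
  by apply; rewrite ?oppr_eq0// ?ltrN2 ?oppr_gt0// ltrNl.
have w_pi : 0 < w < pi by rewrite w_gt0.
by rewrite !divr_gt0 ?sin_gt0_pi ?sinB_mul_cos_gt0 ?subr_sin_mul_cos_gt0.
Qed.

Theorem theorem2p2 (R : realType) :
  (forall (theta x v : R), theta != 0 -> inGamma theta x v ->
     0 <= LambdaRad x theta /\
     exists d : R, dH (0, 1) (x, v) = d%:E /\ d ^+ 2 / 2 = Lambda x theta) /\
  (forall (x v : R), inGamma 0 x v ->
     x = 0 /\
     exists d : R, dH (0, 1) (0, v) = d%:E /\
       d ^+ 2 / 2 = 2 * (Num.sqrt v - 1) ^+ 2).
Proof.
split=> [theta x v theta0 | x v] [v0 [/andP[lo hi] [xE _]]]; last first.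
  split; first by rewrite -xE /fH eqxx.
  exists (2 * Num.sqrt ((Num.sqrt v - 1) ^+ 2)).
  rewrite -{1}(sqr_sqrtr v0) dH_vertical ?sqrtr_ge0//; split=> //.
  by rewrite exprMn sqr_sqrtr ?sqr_ge0//; field.
pose w := theta / 2; pose y := Num.sqrt v.
have thetaE : theta = 2 * w by rewrite /w; field.
have w0 : w != 0 by rewrite mulf_neq0// invr_eq0 pnatr_eq0.
have wpi : - pi < w < pi by rewrite /w; lra.
have y0 : 0 <= y by exact: sqrtr_ge0.
have vE : v = y ^+ 2 by rewrite sqr_sqrtr.
have [D0 N0] := cycloid_factors_gt0 w0 wpi.
have s0 : sin w != 0 by apply: contraTneq D0 => ->; rewrite invr0 mulr0 ltxx.
have d0 : w - sin w * cos w != 0 by apply: contraTneq D0 => ->; rewrite mul0r ltxx.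
have sE : sin theta = 2 * sin w * cos w.
  by rewrite thetaE mulr_natl sin_mulr2n -mulr_natl; ring.
have cE : cos theta = 1 - 2 * sin w ^+ 2.
  by rewrite thetaE mulr_natl cos_mulr2n cos2sin2 -mulr_natl; ring.
have {}xE : x = ((y ^+ 2 + 1) * (w - sin w * cos w) +
    2 * y * (sin w - w * cos w)) / sin w ^+ 2.
  by rewrite -xE /fH (negbTE theta0) sE -/w -/y vE thetaE; field.
have cs2 : cos w ^+ 2 = 1 - sin w ^+ 2 by exact: cos2sin2.
(* As [x] is quadratic in [y], completing the square turns the radicand into the square of an
   expression affine in [y]; its nonnegativity selects the branch used in [Lambda]. *)
pose root := 2 * (y * ((w - sin w * cos w) / sin w) + (sin w - w * cos w) / sin w).
have root0 : 0 <= root.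
  exact: mulr_ge0 _ (addr_ge0 (mulr_ge0 y0 (ltW D0)) (ltW N0)).
have radE : LambdaRad x theta = root ^+ 2.
  by rewrite /LambdaRad /root sE cE thetaE xE; field: cs2.
split; first by rewrite radE sqr_ge0.
pose k := (y - cos w) / sin w.
exists (2 * Num.sqrt (w ^+ 2 * (1 + k ^+ 2))); rewrite vE; split.
  (* With this [k], the value of [fH] is the horizontal displacement of the cycloid arc. *)
  by apply: dH_harmonic => //; rewrite xE /k; field: cs2.
rewrite exprMn sqr_sqrtr; last by rewrite mulr_ge0 ?addr_ge0 ?sqr_ge0.
rewrite /Lambda radE sqrtr_sqr ger0_norm// sE cE thetaE xE /root /k.
have d2 : 2 * w - 2 * sin w * cos w != 0.
  by rewrite -mulrA -mulrBr mulf_neq0 ?pnatr_eq0.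
by field: cs2; rewrite s0.
Qed.
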